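(* Let $\mathfrak{X}$ be a Banach space and let $\Phi:t\mapsto\Phi(t)$ be a function from $[0,\infty)$ to contractions on $\mathfrak{X}$ such that $\Phi(0)=\mathbf{1}$. Let $\{U_A(t)\}_{t\ge0}$ be a contraction $C_0$-semigroup on $\mathfrak{X}$ with generator $A$, and let $D\subset\mathrm{dom}(A)$ be a core of $A$. Suppose that $\Phi$ has a strong right-derivative $\Phi'(+0)$ at $t=0$ and that for all $x\in D$ $$\Phi'(+0)x:=\lim_{t\to+0}\frac1t(\Phi(t)-\mathbf{1})x=-Ax .$$ Then for all $t\ge0$ and all $x\in\mathfrak{X}$, $$\lim_{n\to\infty}\left\|\left([\Phi(t/n)]^n-e^{n(\Phi(t/n)-\mathbf{1})}\right)x\right\|=0,$$ and consequently $$\lim_{n\to\infty}[\Phi(t/n)]^n x=U_A(t)x .$$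
   Context: $\mathbf{1}$ is the identity operator. Sign convention: the generator $A$ of a $C_0$-semigroup $\{U_A(t)\}_{t\ge0}$ is defined so that $U_A(t)=e^{-tA}$, i.e. $-Ax=\lim_{t\to+0}t^{-1}(U_A(t)-\mathbf{1})x$ for $x\in\mathrm{dom}(A)$; generators of contraction semigroups are then $m$-accretive. A contraction is a bounded linear operator of norm at most $1$. The strong right-derivative $\Phi'(+0)$ is the operator defined by $\Phi'(+0)x=\lim_{t\to+0}t^{-1}(\Phi(t)-\mathbf{1})x$ on the set $\mathrm{dom}(\Phi'(+0))$ of those $x$ for which this norm limit exists. *)

(* Defs.v *)
From HB Require Import structures.
From mathcomp Require Import all_boot all_order all_algebra.
From mathcomp Require Import all_classical all_reals all_analysis.
From mathcomp Require Export complex.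
Set Implicit Arguments.
Unset Strict Implicit.
Unset Printing Implicit Defensive.
Import Order.TTheory GRing.Theory Num.Theory.
Import numFieldNormedType.Exports.
Local Open Scope classical_set_scope.
Local Open Scope ring_scope.

(* The scalar field K is meant to be R or R[i] for some R : realType.  In both
   cases [0 <= t] says that t is a nonnegative real number (the order of R[i]
   satisfies x <= y iff y - x is real and nonnegative), so [0, oo) is
   {t : K | 0 <= t}, and [t --> 0^'+] is convergence to 0 along positive reals.
   The values at other t of a function defined on all of K are irrelevant.

   A partially defined operator is given by its domain, a set X, together with
   a function X -> X of which only the values on the domain are meaningful. *)

Section Definitions.
Variables (K : numFieldType) (X : completeNormedModType K).

(* Operator norm at most 1; the [is_contraction] of the library asks for a
   Lipschitz constant that is strictly less than 1. *)
Definition contractive (T : {linear X -> X}) : Prop :=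
  forall x, `|T x| <= `|x|.

Definition diff_quot (F : K -> {linear X -> X}) (x : X) (t : K) : X :=
  t^-1 *: (F t x - x).

Definition dom_rderiv0 (F : K -> {linear X -> X}) : set X :=
  [set x | cvg (diff_quot F x t @[t --> 0^'+])].

Definition rderiv0 (F : K -> {linear X -> X}) (x : X) : X :=
  lim (diff_quot F x t @[t --> 0^'+]).

Definition C0_semigroup (U : K -> {linear X -> X}) : Prop :=
  [/\ forall x, U 0 x = x,
      forall s t x, 0 <= s -> 0 <= t -> U (s + t) x = U s (U t x)
    & forall x, U t x @[t --> 0^'+] --> x].

Definition contraction_C0_semigroup (U : K -> {linear X -> X}) : Prop :=
  C0_semigroup U /\ forall t, 0 <= t -> contractive (U t).

(* Sign convention U t = exp (- t A). *)
Definition dom_generator (U : K -> {linear X -> X}) : set X := dom_rderiv0 U.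

Definition generator (U : K -> {linear X -> X}) (x : X) : X := - rderiv0 U x.

Definition op_graph (D : set X) (A : X -> X) : set (X * X) :=
  [set p | D p.1 /\ p.2 = A p.1].

Definition is_subspace (D : set X) : Prop :=
  D 0 /\ forall (a : K) x y, D x -> D y -> D (a *: x + y).

(* D is a core of the operator (domA, A): a linear subspace of domA such that
   A is the closure of its restriction to D. *)
Definition is_core (domA : set X) (A : X -> X) (D : set X) : Prop :=
  [/\ is_subspace D, D `<=` domA
    & closure (op_graph D A) = op_graph domA A].

(* exp(B) x, for B a bounded linear operator. *)
Definition exp_op (B : X -> X) (x : X) : X :=
  limn (series (fun k : nat => (k`!%:R : K)^-1 *: iter k B x)).

End Definitions.

(* Main.v *)
Require Import Defs.
From HB Require Import structures.
From mathcomp Require Import all_boot all_order all_algebra.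
From mathcomp Require Import all_classical all_reals all_analysis.
From mathcomp Require Import ring zify.
Import Order.TTheory GRing.Theory Num.Theory.
Import numFieldNormedType.Exports.
Local Open Scope classical_set_scope.
Local Open Scope ring_scope.

(** Both limits come from one statement, Chernoff's theorem for sequences
    ([cvg_iter_semigroup]): if the contractions F_n and the integers N_n > n
    satisfy N_n (F_n - 1) z -> - t A z for z in the core D, then
    F_n^{N_n} x -> U_t x for every x.

    Cut [0, t] into m pieces of length h = t/m, and let F_n act in m blocks of
    N_n/m steps.  On one block, F_n^{N_n/m} z differs from z - h A z by at most
    about 2 h |A z - w| + h^2 |A w|, for any auxiliary w in D
    ([iter_divn_first_order]): expand the iterate as a telescoping sum and use
    |F^i w - w| <= i |F w - w|.  The same estimate with F_n = U_{h/n} controls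
    U_h y - (y - h A y) ([semigroup_first_order]).  The orbit y_k = U_{kh} x and
    the auxiliary orbit U_{kh} w, with w in dom A close to A x, need not stay in
    D, but D is a core, so finitely many of their points can be replaced by
    points of D close to them in graph norm.  The bounds do not depend on k
    because U_{kh} is a contraction commuting with A; if w is within e of A x and
    m is large, the m local errors add up to a multiple of t e.

    Extending the limit from D to all vectors requires D to be dense, hence
    dom A to be dense.  The usual mollification is used: the integral of the
    orbit over [0, h], divided by h, lies in dom A and tends to x as h -> 0.  The
    integral is built as a limit of Riemann sums on the grids of mesh 1/n
    ([cvg_orbit_int], [orbit_intD], [orbit_int_dom]).

    For the exponentials, exp B x = lim_M (1 + B/M)^M x ([cvg_iter_exp_op]).
    With B = n (Phi(t/n) - 1) and M >= n, the operator 1 + B/M is a convex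
    combination of 1 and Phi(t/n), hence a contraction, and M ((1 + B/M) - 1) is
    B itself.  So Chernoff's theorem for sequences also applies to
    (1 + B_n/M_n)^{M_n} with M_n so large that these powers, applied to x,
    approximate exp B_n x.  Hence the powers and the exponentials both converge
    to U_t x, and their difference tends to 0. *)

Set Implicit Arguments.
Unset Strict Implicit.
Unset Printing Implicit Defensive.

(** * Archimedean scalars and iterates of a contraction *)

Section Archimedean.
Variables (K : numFieldType) (archK : Num.archimedean_axiom K).

Lemma invSn_lt (e : K) : 0 < e -> exists n : nat, n.+1%:R^-1 < e.
Proof.
move=> e0; have [n hn] := archK e^-1; exists n.
have n0 : 0 < n%:R :> K by apply: le_lt_trans hn.
rewrite invf_plt ?posrE ?ltr0Sn //.
apply: le_lt_trans (lt_le_trans hn _); last by rewrite ler_nat.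
by rewrite ger0_norm // invr_ge0 ltW.
Qed.

Lemma cvg_invSn : (fun n => n.+1%:R^-1 : K) @ \oo --> (0 : K).
Proof.
apply/cvgrPdist_le => e e0; have [n hn] := invSn_lt e0.
near=> k; rewrite sub0r normrN ger0_norm ?invr_ge0 ?ler0n //.
apply: le_trans (ltW hn); rewrite lef_pV2 ?posrE ?ltr0Sn // ler_nat ltnS.
by near: k; exists n.
Unshelve. all: by end_near. Qed.

Lemma cvg_inv_gt_id (N : nat -> nat) : (forall n, n < N n)%N ->
  (fun n => (N n)%:R^-1 : K) @ \oo --> (0 : K).
Proof.
move=> hN; apply/cvgrPdist_le => e e0.
move/cvgrPdist_le/(_ _ e0): cvg_invSn; apply: filterS => n.
rewrite !sub0r !normrN !ger0_norm ?invr_ge0 ?ler0n // => hn; apply: le_trans hn.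
by rewrite lef_pV2 ?posrE ?ltr0n ?ler_nat // (leq_ltn_trans _ (hN n)).
Qed.

End Archimedean.

Section Iterates.
Variables (K : numFieldType) (X : completeNormedModType K).
Implicit Types (F : {linear X -> X}).

Lemma iter_linearB F n x y : iter n F (x - y) = iter n F x - iter n F y.
Proof. by elim: n => //= n ->; rewrite linearB. Qed.


Lemma iter_nonexp F n x : contractive F -> `|iter n F x| <= `|x|.
Proof. by move=> hF; elim: n => //= n; apply: le_trans. Qed.

Lemma iter_nonexpB F n x y : contractive F ->
  `|iter n F x - iter n F y| <= `|x - y|.
Proof. by rewrite -iter_linearB; exact: iter_nonexp. Qed.

Lemma iter_displacement F n x : contractive F ->
  `|iter n F x - x| <= n%:R * `|F x - x|.
Proof.
move=> hF; elim: n => [|n IH]; first by rewrite subrr normr0 mul0r.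
rewrite iterSr -(subrKA (iter n F x)) mulrSr mulrDl mul1r addrC.
apply: le_trans (ler_normD _ _) _; rewrite lerD //.
exact: iter_nonexpB.
Qed.

(** The vector F y - y moves under F in an unknown way; it is compared with a
    vector q on which F acts slowly. *)
Lemma iter_first_order F n y q : contractive F ->
  `|iter n F y - y - n%:R *: (F y - y)|
    <= n%:R * (2 * `|F y - y - q| + n%:R * `|F q - q|).
Proof.
move=> hF; set u := F y - y; set c := 2 * _ + _.
suff H i : (i <= n)%N -> `|iter i F y - y - i%:R *: u| <= i%:R * c by exact: H.
elim: i => [_|i IH hi]; first by rewrite /= subrr scale0r subrr normr0 mul0r.
have -> : iter i.+1 F y - y - i.+1%:R *: u =
   (iter i F y - y - i%:R *: u) + (iter i F u - u).
  rewrite {3}/u iter_linearB -iterSr mulrSr scalerDl scale1r.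
  move: (iter i.+1 F y) (iter i F y) => p r.
  by rewrite [RHS]addrACA -opprD [_ + (p - r)]addrC subrKA.
rewrite mulrSr mulrDl mul1r; apply: le_trans (ler_normD _ _) _.
apply: lerD; first exact: IH (ltnW hi).
(* Only v - q is estimated crudely, by twice its norm. *)
have split_u v : iter i F v - v = (iter i F (v - q) - (v - q)) + (iter i F q - q).
  by rewrite iter_linearB opprB addrACA subrK [q - v - q]addrAC subrr sub0r.
rewrite (split_u u).
apply: le_trans (ler_normD _ _) _; apply: lerD.
  apply: le_trans (ler_normB _ _) _.
  by rewrite mulr_natl mulr2n lerD2r iter_nonexp.
apply: le_trans (iter_displacement _ _ hF) _.
by rewrite ler_wpM2r // ler_nat ltnW.
Qed.

End Iterates.

Section FirstOrder.
Variables (K : numFieldType) (X : completeNormedModType K).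

Lemma cvg_divn_ratio (N : nat -> nat) (m : nat) : (0 < m)%N ->
  (forall n, 0 < N n)%N -> (fun n => (N n)%:R^-1 : K) @ \oo --> (0 : K) ->
  (fun n => (N n %/ m)%:R / (N n)%:R : K) @ \oo --> (m%:R^-1 : K).
Proof.
move=> m0 N0 hN; apply/cvgrPdist_le => e e0.
move/cvgrPdist_le/(_ _ e0): hN; apply: filterS => n; apply: le_trans.
have m0' : m%:R != 0 :> K by rewrite pnatr_eq0 -lt0n.
have N0' : (N n)%:R != 0 :> K by rewrite pnatr_eq0 -lt0n.
have -> : m%:R^-1 - (N n %/ m)%:R / (N n)%:R
    = (N n %% m)%:R / m%:R / (N n)%:R :> K.
  have : (N n)%:R = (N n %/ m)%:R * m%:R + (N n %% m)%:R :> K.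
    by rewrite -natrM -natrD -divn_eq.
  move: N0'; set a : K := (N n)%:R; set b : K := (N n %/ m)%:R.
  move=> N0' E; have -> : (N n %% m)%:R = a - b * m%:R :> K by rewrite E; ring.
  by field; rewrite N0' m0'.
rewrite sub0r normrN normrM ler_piMl // ger0_norm ?divr_ge0 // ler_pdivrMr ?ltr0n //.
by rewrite mul1r ler_nat ltnW // ltn_pmod.
Qed.

(** A fraction 1/m of the N_n steps acts on y like one Euler step of length t/m.
    The vectors a and b stand for A y and A w; by choosing w close to a, the
    error becomes small compared with t/m while b stays fixed. *)
Lemma iter_divn_first_order (F : nat -> {linear X -> X}) (N : nat -> nat)
    (m : nat) (t : K) (y w a b : X) :
  (0 < m)%N -> 0 <= t -> (forall n, contractive (F n)) ->
  (forall n, 0 < N n)%N -> (fun n => (N n)%:R^-1 : K) @ \oo --> (0 : K) ->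
  (fun n => (N n)%:R *: (F n y - y)) @ \oo --> - (t *: a) ->
  (fun n => (N n)%:R *: (F n w - w)) @ \oo --> - (t *: b) ->
  forall e, 0 < e -> \forall n \near \oo,
    `|iter (N n %/ m) (F n) y - y + (t / m%:R) *: a|
      <= 2 * (t / m%:R) * `|a - w| + (t / m%:R) ^+ 2 * `|b| + e.
Proof.
move=> m0 t0 hF N0 hN ha hb e e0.
have hr := cvg_divn_ratio m0 N0 hN.
pose r n : K := (N n %/ m)%:R / (N n)%:R.
pose E n := 2 * r n * `|(N n)%:R *: (F n y - y) + t *: w|
  + r n ^+ 2 * t * `|(N n)%:R *: (F n w - w)|
  + `|r n *: ((N n)%:R *: (F n y - y)) + (t / m%:R) *: a|.
have bound n : `|iter (N n %/ m) (F n) y - y + (t / m%:R) *: a| <= E n.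
  have N0' : (N n)%:R != 0 :> K by rewrite pnatr_eq0 -lt0n.
  have jr : (N n %/ m)%:R = r n * (N n)%:R by rewrite /r divfK.
  have r0 : 0 <= r n by rewrite divr_ge0.
  (* F_n y - y is about - (t/N_n) a, hence this choice of q. *)
  have h := iter_first_order (N n %/ m) y (- (t / (N n)%:R *: w)) (hF n).
  rewrite -(subrK ((N n %/ m)%:R *: (F n y - y)) (iter _ _ _ - y)) -addrA.
  apply: le_trans (ler_normD _ _) _; rewrite /E lerD //; last first.
    by rewrite scalerA -jr.
  apply: le_trans h _.
  have -> : (N n)%:R *: (F n y - y) + t *: w
      = (N n)%:R *: (F n y - y - - (t / (N n)%:R *: w)).
    by rewrite opprK [RHS]scalerDr scalerA [_ * (t / _)]mulrC divfK.
  have -> : F n (- (t / (N n)%:R *: w)) - - (t / (N n)%:R *: w)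
      = - ((t / (N n)%:R) *: (F n w - w)).
    by rewrite linearN linearZ /= -opprD -scalerBr.
  rewrite normrN !normrZ normfV !normr_nat (ger0_norm t0) jr le_eqVlt.
  by apply/orP; left; apply/eqP; field.
have cE : E @ \oo --> (2 * (t / m%:R) * `|a - w| + (t / m%:R) ^+ 2 * `|b| : K).
  have -> : 2 * (t / m%:R) * `|a - w| + (t / m%:R) ^+ 2 * `|b| =
     2 * m%:R^-1 * `|- (t *: a) + t *: w| + m%:R^-1 ^+ 2 * t * `|- (t *: b)|
      + `|m%:R^-1 *: (- (t *: a)) + (t / m%:R) *: a|.
    rewrite [- _ + _]addrC -scalerBr !normrN !normrZ !(ger0_norm t0) scalerN scalerA.
    rewrite [t / _]mulrC addNr normr0 addr0 [`|w - a|]distrC; ring.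
  rewrite /E; apply: cvgD; first apply: cvgD.
  - apply: cvgM; first by apply: cvgM; [exact: cvg_cst|].
    by apply: cvg_norm; apply: cvgD => //; exact: cvg_cst.
  - apply: cvgM; last exact: cvg_norm.
    under eq_fun do rewrite expr2; rewrite expr2.
    by apply: cvgM; [exact: cvgM|exact: cvg_cst].
  - apply: cvg_norm; apply: cvgD; last exact: cvg_cst.
    exact: cvgZ.
move/cvgrPdist_le/(_ _ e0): cE; apply: filterS => n.
set L := 2 * _ * _ + _; move=> hL; apply: le_trans (bound n) _.
have L0 : 0 <= L.
  have h0 : 0 <= t / m%:R by rewrite divr_ge0.
  by apply: addr_ge0; rewrite mulr_ge0 ?exprn_ge0 ?mulr_ge0.
have En0 : 0 <= E n by apply: le_trans (bound n).
rewrite -lerBlDl; apply: le_trans hL; rewrite distrC real_ler_norm //.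
by rewrite realB // ger0_real.
Qed.

End FirstOrder.

(** * Right derivatives and generators *)

Section Generator.
Variables (K : numFieldType) (X : completeNormedModType K).
Implicit Types (F U : K -> {linear X -> X}).

Lemma cvg_right0_dist (f : K -> X) (l : X) :
  f t @[t --> 0^'+] --> l -> forall e, 0 < e ->
  exists2 d, 0 < d & forall t, 0 < t -> t < d -> `|f t - l| <= e.
Proof.
move=> /cvgrPdist_le hf e e0; have [d /= d0 hd] := hf e e0.
exists d => // t t0 td; rewrite distrC; apply: hd => //=.
by rewrite sub0r normrN gtr0_norm.
Qed.

Lemma cvg_diff_quot F x : dom_rderiv0 F x ->
  diff_quot F x t @[t --> 0^'+] --> rderiv0 F x.
Proof. by []. Qed.

Lemma diff_quot_dom F x l : diff_quot F x t @[t --> 0^'+] --> l ->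
  dom_rderiv0 F x /\ rderiv0 F x = l.
Proof.
move=> h; split; first by apply/cvg_ex; exists l.
by apply: cvg_lim => //; exact: norm_hausdorff.
Qed.

Hypothesis archK : Num.archimedean_axiom K.

Lemma cvg_scaled_displacement F x t : (forall x, F 0 x = x) ->
  dom_rderiv0 F x -> 0 <= t ->
  n.+1%:R *: (F (t / n.+1%:R) x - x) @[n --> \oo] --> t *: rderiv0 F x.
Proof.
move=> F0 hx; rewrite le_eqVlt => /orP[/eqP <-|t0].
  under eq_fun do rewrite mul0r F0 subrr scaler0.
  rewrite scale0r; exact: cvg_cst.
have scale_diff n : n.+1%:R *: (F (t / n.+1%:R) x - x)
    = t *: diff_quot F x (t / n.+1%:R).
  rewrite /diff_quot scalerA invf_div mulrCA divff ?gt_eqF // mulr1 //.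
under eq_fun do rewrite scale_diff.
apply: cvgZl_tmp; apply/cvgrPdist_le => e e0.
have [d d0 hd] := cvg_right0_dist (cvg_diff_quot hx) e0.
move/cvgrPdist_lt/(_ _ (divr_gt0 d0 t0)): (cvg_invSn archK).
apply: filterS => n; rewrite sub0r normrN ger0_norm ?invr_ge0 //.
rewrite ltr_pdivlMr // mulrC => tn.
by rewrite distrC hd // divr_gt0.
Qed.

End Generator.

Section Semigroup.
Variables (K : numFieldType) (X : completeNormedModType K).
Hypothesis archK : Num.archimedean_axiom K.
Variables (U : K -> {linear X -> X}) (hU : contraction_C0_semigroup U).
Local Notation A := (generator U).
Local Notation domA := (dom_generator U).

Lemma semigroup0 x : U 0 x = x.
Proof. by case: hU => -[]. Qed.

Lemma semigroupD s t x : 0 <= s -> 0 <= t -> U (s + t) x = U s (U t x).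
Proof. by case: hU => -[_ h _] _; exact: h. Qed.

Lemma semigroup_contr t : 0 <= t -> contractive (U t).
Proof. by case: hU => _; apply. Qed.

Lemma semigroup_dist t x y : 0 <= t -> `|U t x - U t y| <= `|x - y|.
Proof. by rewrite -linearB; move/semigroup_contr. Qed.

Lemma semigroup_cvg0 x : U t x @[t --> 0^'+] --> x.
Proof. by case: hU => -[_ _]. Qed.

Lemma semigroup_iter n s x : 0 <= s -> iter n (U s) x = U (n%:R * s) x.
Proof.
move=> s0; elim: n => [|n /= ->]; first by rewrite mul0r semigroup0.
by rewrite -semigroupD ?mulr_ge0 // mulrSr mulrDl mul1r addrC.
Qed.

Lemma generator_orbit s x : 0 <= s -> domA x ->
  domA (U s x) /\ A (U s x) = U s (A x).
Proof.
move=> s0 hx; have [|h1 h2] := @diff_quot_dom _ _ U (U s x) (U s (rderiv0 U x)).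
  apply/cvgrPdist_le => e e0; near=> t.
  have t0 : 0 < t by near: t; exact: nbhs_right_gt.
  have comm : U t (U s x) = U s (U t x).
    by rewrite -(semigroupD _ (ltW t0) s0) addrC (semigroupD _ s0 (ltW t0)).
  rewrite /diff_quot comm -linearB -linearZ.
  apply: le_trans (semigroup_dist _ _ s0) _.
  by near: t; move/cvgrPdist_le: (cvg_diff_quot hx); apply.
by split => //; rewrite /generator h2 linearN.
Unshelve. all: by end_near. Qed.

Lemma cvg_semigroup_displacement x t : domA x -> 0 <= t ->
  n.+1%:R *: (U (t / n.+1%:R) x - x) @[n --> \oo] --> - (t *: A x).
Proof.
move=> hx t0; rewrite /generator scalerN opprK.
exact (cvg_scaled_displacement archK semigroup0 hx t0).
Qed.

(** A mean value inequality for the orbit of y: U_s is the n-th power of U_{s/n}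
    for every n, so the estimate on iterates applies with m = 1. *)
Lemma semigroup_first_order s y w : domA y -> domA w -> 0 <= s ->
  `|U s y - (y - s *: A y)| <= 2 * s * `|A y - w| + s ^+ 2 * `|A w|.
Proof.
move=> hy hw s0; apply/ler_addgt0Pr => e e0.
have F0 n : contractive (U (s / n.+1%:R)) by apply: semigroup_contr; rewrite divr_ge0.
have := iter_divn_first_order (ltn0Sn 0) s0 F0 (fun n => ltn0Sn n) (cvg_invSn archK)
  (cvg_semigroup_displacement hy s0) (cvg_semigroup_displacement hw s0) e0.
case=> n _ /(_ n (leqnn n)).
rewrite divn1 divr1 semigroup_iter ?divr_ge0 // mulrC divfK ?pnatr_eq0 //.
by rewrite opprB addrA addrAC.
Qed.

End Semigroup.

(** * The integral of an orbit and the density of the domain *)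

Lemma cauchy_seq_cvg (K : numFieldType) (X : completeNormedModType K)
    (u : nat -> X) :
  (forall e, 0 < e -> exists n0, forall n m, (n0 <= n)%N -> (n0 <= m)%N ->
    `|u n - u m| <= e) -> cvg (u @ \oo).
Proof.
move=> hu; apply: cauchy_cvg; apply: cauchy_exP => e e0.
have [n0 hn0] := hu _ (divr_gt0 e0 (ltr0Sn _ 1)).
exists (u n0), n0 => // n /= hn; rewrite -ball_normE /=.
by apply: le_lt_trans (hn0 _ _ (leqnn _) hn) _; rewrite ltr_pdivrMr // ltr_pMr // ltr1n.
Qed.

Section Floor.
Variables (K : numFieldType) (archK : Num.archimedean_axiom K).

Definition floorn (h : K) : nat := xget 0%N [set n | n%:R <= h < n.+1%:R].

Lemma floornP h : 0 <= h -> (floorn h)%:R <= h < (floorn h).+1%:R.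
Proof.
move=> h0; rewrite /floorn; case: xgetP => [n _ //|none].
have exh : exists n, h < n.+1%:R.
  have [n hn] := archK h; exists n; rewrite ger0_norm // in hn.
  by apply: lt_trans hn _; rewrite ltr_nat.
case: (ex_minnP exh) => -[|n] hn minn; first by case: (none 0%N); rewrite /= h0.
case: (none n.+1); rewrite /= hn andbT.
rewrite real_leNgt ?ger0_real //.
by apply/negP => /minn; rewrite ltnn.
Qed.

Lemma floorn_ge h n : 0 <= h -> n%:R <= h -> (n <= floorn h)%N.
Proof.
move=> h0 hn; have /andP[_ hlt] := floornP h0.
by rewrite -ltnS -(ltr_nat K); apply: le_lt_trans hlt.
Qed.

Lemma floorn_lt h n : 0 <= h -> h < n%:R -> (floorn h < n)%N.
Proof.
move=> h0 hn; have /andP[hle _] := floornP h0.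
by rewrite -(ltr_nat K); apply: le_lt_trans hn.
Qed.

End Floor.

Section RiemannSum.
Variables (K : numFieldType) (X : completeNormedModType K).
Variables (U : K -> {linear X -> X}) (hU : contraction_C0_semigroup U).

(** The left Riemann sum over [0, L/N] of the orbit of x.  Working on the fixed
    grid of mesh 1/N, whatever the length, makes sums over consecutive intervals
    add up exactly. *)
Definition orbit_sum (N L : nat) (x : X) : X :=
  N%:R^-1 *: \sum_(0 <= i < L) U (i%:R / N%:R) x.

Lemma orbit_sumD N L1 L2 x : orbit_sum N (L1 + L2) x =
  orbit_sum N L1 x + U (L1%:R / N%:R) (orbit_sum N L2 x).
Proof.
rewrite /orbit_sum linearZ /= -scalerDr; congr (_ *: _).
rewrite linear_sum (big_cat_nat (n := L1)) ?leq_addr //=; congr (_ + _).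
rewrite -{1}[L1]add0n big_addn addKn; apply: eq_bigr => i _.
by rewrite -(semigroupD hU) ?divr_ge0 // -mulrDl -natrD addnC.
Qed.

Lemma orbit_sum_le N L x : `|orbit_sum N L x| <= L%:R / N%:R * `|x|.
Proof.
rewrite /orbit_sum normrZ ger0_norm ?invr_ge0 // [_ / _]mulrC -mulrA.
rewrite ler_wpM2l ?invr_ge0 //; apply: le_trans (ler_norm_sum _ _ _) _.
apply: le_trans (_ : \sum_(0 <= i < L) `|x| <= _).
  by apply: ler_sum => i _; apply: (semigroup_contr hU); rewrite divr_ge0.
by rewrite sumr_const_nat subn0 mulr_natl.
Qed.

Lemma orbit_sum_mono N L1 L2 x : (L1 <= L2)%N ->
  `|orbit_sum N L2 x - orbit_sum N L1 x| <= (L2 - L1)%:R / N%:R * `|x|.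
Proof.
move=> /subnKC {1}<-; rewrite orbit_sumD addrC addKr.
by apply: le_trans (orbit_sum_le _ _ _); apply: (semigroup_contr hU); rewrite divr_ge0.
Qed.

Lemma orbit_sum_near N L x e :
  (forall s, 0 <= s -> s <= L%:R / N%:R -> `|U s x - x| <= e) ->
  `|orbit_sum N L x - (L%:R / N%:R) *: x| <= L%:R / N%:R * e.
Proof.
move=> he; have -> : (L%:R / N%:R) *: x = N%:R^-1 *: \sum_(0 <= i < L) x.
  by rewrite sumr_const_nat subn0 mulrC -scalerA scaler_nat.
rewrite /orbit_sum -scalerBr -sumrB normrZ ger0_norm ?invr_ge0 //.
rewrite [_ / _]mulrC -mulrA ler_wpM2l ?invr_ge0 //.
apply: le_trans (ler_norm_sum _ _ _) _.
apply: le_trans (_ : \sum_(0 <= i < L) e <= _); last first.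
  by rewrite sumr_const_nat subn0 mulr_natl.
apply: ler_sum_nat => i /andP[_ iL].
by rewrite he ?divr_ge0 // ler_wpM2r ?invr_ge0 // ler_nat ltnW.
Qed.

(** By the semigroup law, the oscillation of the orbit on any cell of the grid
    is at most its oscillation on the first one; this is what makes the sums
    converge although the orbit is only assumed to be continuous at 0. *)
Lemma orbit_sum_refine N M L x e : (0 < N)%N -> (0 < M)%N ->
  (forall s, 0 <= s -> s <= N%:R^-1 -> `|U s x - x| <= e) ->
  `|orbit_sum (N * M) (L * M) x - orbit_sum N L x| <= L%:R / N%:R * e.
Proof.
move=> N0 M0 he.
have N0' : N%:R != 0 :> K by rewrite pnatr_eq0 -lt0n.
have M0' : M%:R != 0 :> K by rewrite pnatr_eq0 -lt0n.
have cell : `|orbit_sum (N * M) M x - orbit_sum N 1 x| <= N%:R^-1 * e.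
  have -> : orbit_sum N 1 x = (M%:R / (N * M)%:R) *: x.
    rewrite /orbit_sum big_nat1 mul0r (semigroup0 hU); congr (_ *: _).
    by rewrite natrM; field; rewrite M0' N0'.
  have E : N%:R^-1 = M%:R / (N * M)%:R :> K.
    by rewrite natrM; field; rewrite M0' N0'.
  by rewrite E in he *; exact: orbit_sum_near.
elim: L => [|L IH].
  by rewrite /orbit_sum !big_geq // !scaler0 subrr normr0 !mul0r.
rewrite mulSn addnC -[L.+1]addn1 !orbit_sumD opprD addrACA natrD.
rewrite !mulrDl mul1r; apply: le_trans (ler_normD _ _) _; rewrite lerD //.
have -> : (L * M)%:R / (N * M)%:R = L%:R / N%:R :> K.
  by rewrite !natrM; field; rewrite N0' M0'.
by apply: le_trans cell; apply: (semigroup_dist hU); rewrite divr_ge0.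
Qed.

End RiemannSum.

Section OrbitIntegral.
Variables (K : numFieldType) (X : completeNormedModType K).
Hypothesis archK : Num.archimedean_axiom K.
Variables (U : K -> {linear X -> X}) (hU : contraction_C0_semigroup U).

Lemma orbit_near0 x e : 0 < e -> exists2 d, 0 < d &
  forall s, 0 <= s -> s < d -> `|U s x - x| <= e.
Proof.
move=> e0; have [d d0 hd] := cvg_right0_dist (@semigroup_cvg0 _ _ _ hU x) e0.
exists d => // s; rewrite le_eqVlt => /orP[/eqP <- _|]; last exact: hd.
by rewrite (semigroup0 hU) subrr normr0 ltW.
Qed.

Definition grid_point (h : K) (n : nat) : nat := floorn (h * n.+1%:R).

Lemma grid_pointP h n : 0 <= h ->
  (grid_point h n)%:R / n.+1%:R <= h < ((grid_point h n)%:R + 1) / n.+1%:R.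
Proof.
move=> h0; rewrite ler_pdivrMr ?ltr0Sn // ltr_pdivlMr ?ltr0Sn // natr1.
by apply: floornP => //; rewrite mulr_ge0.
Qed.

Definition orbit_int (h : K) (x : X) : X :=
  limn (fun n => orbit_sum U n.+1 (grid_point h n) x).

(** The sum on the common refinement serves to compare two grids; the term in
    |x| pays for the cell that the floor cuts off. *)
Lemma orbit_int_refine h n m x e : 0 <= h -> 0 <= e ->
  (forall s, 0 <= s -> s <= n.+1%:R^-1 -> `|U s x - x| <= e) ->
  `|orbit_sum U (n.+1 * m.+1) (floorn (h * (n.+1 * m.+1)%:R)) x
     - orbit_sum U n.+1 (grid_point h n) x| <= h * e + n.+1%:R^-1 * `|x|.
Proof.
move=> h0 e0 he; set L := grid_point h n; set N := (n.+1 * m.+1)%N.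
have hN0 : 0 <= h * N%:R by rewrite mulr_ge0.
have /andP[Lle Llt] := floornP archK (mulr_ge0 h0 (ler0n K n.+1)).
have Lm : (L * m.+1 <= floorn (h * N%:R))%N.
  by apply: floorn_ge => //; rewrite !natrM mulrA ler_wpM2r.
have Lm' : (floorn (h * N%:R) - L * m.+1 <= m.+1)%N.
  rewrite leq_subLR -mulSnr ltnW // floorn_lt // !natrM mulrA.
  by rewrite ltr_pM2r ?ltr0Sn.
apply: le_trans (ler_distD (orbit_sum U N (L * m.+1) x) _ _) _.
rewrite addrC; apply: lerD.
  apply: le_trans (orbit_sum_refine hU _ _ _ he) _ => //.
  by rewrite ler_wpM2r //; have /andP[] := grid_pointP n h0.
apply: le_trans (orbit_sum_mono hU _ _ Lm) _; rewrite ler_wpM2r //.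
rewrite ler_pdivrMr ?ltr0n ?muln_gt0 // [X in _ <= _ * X]natrM mulKf ?pnatr_eq0 //.
by rewrite ler_nat.
Qed.

Lemma cvg_orbit_int h x : 0 <= h ->
  orbit_sum U n.+1 (grid_point h n) x @[n --> \oo] --> orbit_int h x.
Proof.
move=> h0; apply: cauchy_seq_cvg => e e0.
pose e1 := e / (2 * (h + `|x|)+ 1).
have c0 : 0 < 2 * (h + `|x|) + 1 by rewrite ltr_wpDl // mulr_ge0 // addr_ge0.
have e10 : 0 < e1 by rewrite divr_gt0.
have [d d0 hd] := orbit_near0 x e10.
have [n0 hn0] := invSn_lt archK d0.
have [n1 hn1] := invSn_lt archK e10.
have inv_le n k : (n <= k)%N -> k.+1%:R^-1 <= n.+1%:R^-1 :> K.
  by move=> nk; rewrite lef_pV2 ?posrE ?ltr0Sn // ler_nat.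
have step n m : (maxn n0 n1 <= n)%N ->
  `|orbit_sum U (n.+1 * m.+1) (floorn (h * (n.+1 * m.+1)%:R)) x
     - orbit_sum U n.+1 (grid_point h n) x| <= (h + `|x|) * e1.
  rewrite geq_max => /andP[nn0 nn1].
  apply: le_trans (@orbit_int_refine h n m x e1 h0 (ltW e10) _) _.
    move=> s s0 sn; apply: hd => //; apply: le_lt_trans sn _.
    exact: le_lt_trans (inv_le _ _ nn0) hn0.
  rewrite mulrDl lerD2l mulrC ler_wpM2l //.
  exact: le_trans (inv_le _ _ nn1) (ltW hn1).
exists (maxn n0 n1) => n m hn hm.
apply: le_trans (ler_distD
  (orbit_sum U (n.+1 * m.+1) (floorn (h * (n.+1 * m.+1)%:R)) x) _ _) _.
rewrite distrC; have := lerD (step n m hn) (step m n hm).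
rewrite mulnC => hs; apply: le_trans hs _.
rewrite -mulrDl -mulr2n -mulr_natl /e1 mulrCA ler_piMr ?ltW //.
by rewrite ltr_pdivrMr // mul1r ltr_pwDr.
Qed.

Lemma cvg_grid_orbit h v : 0 <= h ->
  U ((grid_point h n)%:R / n.+1%:R) v @[n --> \oo] --> U h v.
Proof.
move=> h0; apply/cvgrPdist_le => e e0.
have [d d0 hd] := orbit_near0 v e0; have [n0 hn0] := invSn_lt archK d0.
exists n0 => // n /= nn0; have /andP[gle glt] := grid_pointP n h0.
set g := _ / _ in gle *; have g0 : 0 <= g by rewrite divr_ge0.
rewrite -[h in U h](subrKC g) (semigroupD hU) ?subr_ge0 //.
apply: le_trans (semigroup_dist hU _ _ g0) _; apply: hd; first by rewrite subr_ge0.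
apply: lt_le_trans (_ : n.+1%:R^-1 <= _).
  by rewrite ltrBlDl -[n.+1%:R^-1]mul1r -mulrDl.
by apply: le_trans (ltW hn0); rewrite lef_pV2 ?posrE ?ltr0Sn // ler_nat.
Qed.

Lemma orbit_intD s h x : 0 <= s -> 0 <= h ->
  orbit_int (s + h) x = orbit_int s x + U s (orbit_int h x).
Proof.
move=> s0 h0; have sh0 : 0 <= s + h by rewrite addr_ge0.
apply: cvg_lim; first exact: norm_hausdorff.
pose g n : K := (grid_point s n)%:R / n.+1%:R.
have c1 : orbit_sum U n.+1 (grid_point s n + grid_point h n) x @[n --> \oo]
    --> orbit_int s x + U s (orbit_int h x).
  under eq_fun do rewrite orbit_sumD //.
  apply: cvgD; first exact: cvg_orbit_int.
  apply: (@cvg_trans _ (((U (g n) (orbit_sum U n.+1 (grid_point h n) x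
      - orbit_int h x)) + U (g n) (orbit_int h x)) @[n --> \oo])).
    by under [X in _ --> X @ _]eq_fun do rewrite linearB subrK.
  rewrite -[U s _]add0r; apply: cvgD; last exact: cvg_grid_orbit.
  apply/cvgrPdist_le => e e0.
  have /cvgrPdist_le/(_ _ e0) := @cvg_orbit_int h x h0.
  apply: filterS => n; rewrite sub0r normrN distrC; apply: le_trans.
  by apply: (semigroup_contr hU); rewrite divr_ge0.
have c2 : orbit_sum U n.+1 (grid_point (s + h) n) x
    - orbit_sum U n.+1 (grid_point s n + grid_point h n) x @[n --> \oo] --> (0 : X).
  have cx : n.+1%:R^-1 * `|x| @[n --> \oo] --> (0 : K).
    rewrite -[X in _ --> X](mul0r `|x|).
    by apply: cvgM; [exact: cvg_invSn|exact: cvg_cst].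
  apply/cvgrPdist_le => e e0; move/cvgrPdist_le/(_ _ e0): cx.
  apply: filterS => n; rewrite !sub0r !normrN ger0_norm ?mulr_ge0 ?invr_ge0 //.
  apply: le_trans.
  have /andP[sl su] := floornP archK (mulr_ge0 s0 (ler0n K n.+1)).
  have /andP[hl hu] := floornP archK (mulr_ge0 h0 (ler0n K n.+1)).
  have shn0 : 0 <= (s + h) * n.+1%:R by rewrite mulr_ge0.
  apply: le_trans (orbit_sum_mono hU _ _ _) _.
    by apply: floorn_ge => //; rewrite natrD mulrDl lerD.
  rewrite ler_wpM2r // ler_piMl ?invr_ge0 // (ler_nat _ _ 1) leq_subLR -ltnS.
  apply: floorn_lt => //; rewrite mulrDl.
  have -> : ((grid_point s n + grid_point h n + 1).+1 =
    (grid_point s n).+1 + (grid_point h n).+1)%N by rewrite addn1 addnS addSn.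
  by rewrite natrD ltrD.
rewrite -[X in _ --> X]add0r.
under eq_fun => n do
  rewrite -[orbit_sum _ _ _ _](subrK
    (orbit_sum U n.+1 (grid_point s n + grid_point h n) x)).
exact: cvgD c2 c1.
Qed.

Lemma orbit_int_near h x e : 0 <= h ->
  (forall s, 0 <= s -> s <= h -> `|U s x - x| <= e) ->
  `|orbit_int h x - h *: x| <= h * e.
Proof.
move=> h0 he; have e0 : 0 <= e by rewrite (le_trans _ (he 0 (lexx 0) h0)).
apply/ler_addgt0Pr => r r0.
pose g n : K := (grid_point h n)%:R / n.+1%:R.
have cg : g n *: x @[n --> \oo] --> h *: x.
  apply: cvgZr_tmp; apply/cvgrPdist_le => d d0.
  move/cvgrPdist_le/(_ _ d0): (cvg_invSn archK); apply: filterS => n.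
  rewrite sub0r normrN ger0_norm ?invr_ge0 // => hn.
  have /andP[gl gu] := grid_pointP n h0.
  rewrite ger0_norm ?subr_ge0 //; apply: le_trans (ltW _) hn.
  by rewrite ltrBlDl -[n.+1%:R^-1]mul1r -mulrDl.
have cI : orbit_sum U n.+1 (grid_point h n) x - g n *: x @[n --> \oo]
    --> orbit_int h x - h *: x by apply: cvgB => //; exact: cvg_orbit_int.
move/cvgrPdist_le/(_ _ r0): cI => [n _ /(_ n (leqnn n))] /= hn.
rewrite -(subrK (orbit_sum U n.+1 (grid_point h n) x - g n *: x)
  (orbit_int h x - h *: x)).
apply: le_trans (ler_normD _ _) _; rewrite [leRHS]addrC lerD //.
have /andP[gl gu] := grid_pointP n h0.
apply: le_trans (orbit_sum_near (e := e) _) _; last by rewrite ler_wpM2r.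
by move=> s s0 sn; apply: he => //; apply: le_trans gl.
Qed.

Lemma orbit_mean_near h x e : 0 < h ->
  (forall s, 0 <= s -> s <= h -> `|U s x - x| <= e) ->
  `|x - h^-1 *: orbit_int h x| <= e.
Proof.
move=> h0 he; have near_hx := orbit_int_near (ltW h0) he.
have -> : x - h^-1 *: orbit_int h x = h^-1 *: (h *: x - orbit_int h x).
  by rewrite scalerBr scalerA mulVf ?gt_eqF // scale1r.
by rewrite normrZ gtr0_norm ?invr_gt0 // ler_pdivrMl // distrC.
Qed.

(** By additivity, (U_t - 1) (int_0^h) = (U_h - 1) (int_0^t), and the latter
    divided by t tends to U_h x - x. *)
Lemma orbit_int_dom h x : 0 <= h -> dom_generator U (orbit_int h x).
Proof.
move=> h0; apply: (proj1 (@diff_quot_dom _ _ _ _ (U h x - x) _)).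
apply/cvgrPdist_le => e e0.
have e20 : 0 < e / 2 by rewrite divr_gt0.
have [d d0 hd] := orbit_near0 x e20.
near=> t.
have t0 : 0 < t by near: t; exact: nbhs_right_gt.
have td : t < d by near: t; exact: nbhs_right_lt.
have -> : diff_quot U (orbit_int h x) t
    = U h (t^-1 *: orbit_int t x) - t^-1 *: orbit_int t x.
  have UI : U t (orbit_int h x) = orbit_int h x + U h (orbit_int t x) - orbit_int t x.
    rewrite -(orbit_intD x h0 (ltW t0)) (addrC h t) (orbit_intD x (ltW t0) h0).
    by rewrite [RHS]addrC addKr.
  by rewrite /diff_quot UI linearZ /= -scalerBr addrAC [_ + U h _]addrC addrK.
set q := t^-1 *: _.
have qx : `|x - q| <= e / 2.
  apply: orbit_mean_near => // s s0 st; apply: hd => //.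
  exact: le_lt_trans td.
have -> : U h x - x - (U h q - q) = U h (x - q) - (x - q).
  rewrite (linearB (U h)); move: (U h x) (U h q) => p r.
  by rewrite !opprB [q - r]addrC [LHS]addrACA [- _ + q]addrC.
rewrite [leRHS]splitr; apply: le_trans (ler_normB _ _) _.
rewrite lerD //; apply: le_trans qx; exact: (semigroup_contr hU).
Unshelve. all: by end_near. Qed.

Lemma dom_generatorZ c x : dom_generator U x -> dom_generator U (c *: x).
Proof.
move=> hx; apply: (proj1 (@diff_quot_dom _ _ _ _ (c *: rderiv0 U x) _)).
apply: (@cvg_trans _ (c *: diff_quot U x t @[t --> 0^'+])); last first.
  by apply: cvgZl_tmp; exact: cvg_diff_quot.
under [X in _ --> X @ _]eq_fun do
  rewrite /diff_quot scalerA mulrC -scalerA scalerBr -linearZ.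
by [].
Qed.

Lemma dom_generator_dense x e : 0 < e ->
  exists2 y, dom_generator U y & `|x - y| <= e.
Proof.
move=> e0; have [d d0 hd] := orbit_near0 x e0.
pose h := d / 2; have h0 : 0 < h by rewrite divr_gt0.
exists (h^-1 *: orbit_int h x).
  by apply: dom_generatorZ; apply: orbit_int_dom; exact: ltW.
apply: orbit_mean_near => // s s0 st; apply: hd => //.
apply: le_lt_trans st _; by rewrite ltr_pdivrMr // ltr_pMr // ltr1n.
Qed.

End OrbitIntegral.

(** * Chernoff's theorem for sequences of contractions *)

Section Telescoping.
Variables (K : numFieldType) (X : normedModType K).

(** Local errors add up: each one is propagated by the remaining applications
    of G, which do not increase distances. *)
Lemma iter_telescope (G : X -> X) (y : nat -> X) (c : K) m :
  (forall u v, `|G u - G v| <= `|u - v|) ->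
  (forall k, (k < m)%N -> `|G (y k) - y k.+1| <= c) ->
  `|iter m G (y 0%N) - y m| <= m%:R * c.
Proof.
move=> hG; elim: m => [_|m IH hy]; first by rewrite subrr normr0 mul0r.
apply: le_trans (ler_distD (G (y m)) _ _) _.
rewrite mulrSr mulrDl mul1r lerD //; last exact: hy.
by apply: le_trans (hG _ _) _; apply: IH => k km; apply: hy; exact: ltnW.
Qed.

End Telescoping.

Section Chernoff.
Variables (K : numFieldType) (X : completeNormedModType K).
Hypothesis archK : Num.archimedean_axiom K.
Variables (U : K -> {linear X -> X}) (hU : contraction_C0_semigroup U).
Variables (D : set X) (hD : is_core (dom_generator U) (generator U) D).
Local Notation A := (generator U).
Local Notation domA := (dom_generator U).

Lemma core_approx y e : domA y -> 0 < e ->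
  exists z, [/\ D z, `|y - z| <= e & `|A y - A z| <= e].
Proof.
move=> hy e0; case: hD => _ _ hcl.
have : closure (op_graph D A) (y, A y) by rewrite hcl.
move=> /(_ (ball (y, A y) e)) []; first exact: nbhsx_ballx.
move=> [z z'] [[/= Dz ->] [/=]]; rewrite -!ball_normE /= => h1 h2.
by exists z; split => //; exact: ltW.
Qed.

Lemma core_dom z : D z -> domA z.
Proof. by case: hD => _ h _; exact: h. Qed.

Lemma core_dense x e : 0 < e -> exists2 z, D z & `|x - z| <= e.
Proof.
move=> e0; have e20 : 0 < e / 2 by rewrite divr_gt0.
have [y hy xy] := dom_generator_dense archK hU x e20.
have [z [Dz yz _]] := core_approx hy e20.
exists z => //; rewrite [leRHS]splitr.
by apply: le_trans (ler_distD y _ _) _; rewrite lerD.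
Qed.

Variables (F : nat -> {linear X -> X}) (N : nat -> nat) (t : K).
Hypotheses (hF : forall n, contractive (F n)) (hN : forall n, (n < N n)%N).
Hypotheses (t0 : 0 <= t) (hFD : forall z, D z ->
  (fun n => (N n)%:R *: (F n z - z)) @ \oo --> - (t *: A z)).

Let N_gt0 n : (0 < N n)%N.
Proof. exact: leq_ltn_trans (hN n). Qed.

Let cvgN : (fun n => (N n)%:R^-1 : K) @ \oo --> (0 : K).
Proof. exact: cvg_inv_gt_id. Qed.

(** The local error at U_s x, uniform in s: the auxiliary vector is U_s w, which
    is as close to A U_s x = U_s A x as w is to A x, while |A U_s w| <= |A w|.
    Both U_s x and U_s w are moved into D, at distance d in graph norm. *)
Lemma orbit_step (m : nat) (s : K) (x w : X) (e d : K) : (0 < m)%N -> 0 <= s ->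
  domA x -> domA w -> `|A x - w| <= e -> 0 < d -> d <= e ->
  t / m%:R * (`|A w| + e) <= e ->
  \forall n \near \oo, `|iter (N n %/ m) (F n) (U s x) - U (t / m%:R) (U s x)|
    <= 11 * (t / m%:R * e) + 3 * d.
Proof.
move=> m0 s0 hx hw xw d0 de; set h := t / m%:R => he.
have h0 : 0 <= h by rewrite divr_ge0.
have [hy Ay] := generator_orbit hU s0 hx.
have [hu Au] := generator_orbit hU s0 hw.
set y := U s x in hy Ay *; set u := U s w in hu Au.
have Ayu : `|A y - u| <= e by rewrite Ay; apply: le_trans xw; exact: semigroup_dist.
have [z [Dz yz Ayz]] := core_approx hy d0.
have [v [Dv uv Auv]] := core_approx hu d0.
have Auw : `|A u| <= `|A w| by rewrite Au; exact: semigroup_contr.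
have Azv : `|A z - v| <= 3 * e.
  have -> : 3 * e = e + e + e by ring.
  apply: le_trans (ler_distD u _ _) _; apply: lerD; last exact: le_trans de.
  apply: le_trans (ler_distD (A y) _ _) _; rewrite distrC.
  by apply: lerD => //; exact: le_trans de.
have Avw : `|A v| <= `|A w| + e.
  rewrite -(subrK (A u) (A v)) addrC; apply: le_trans (ler_normD _ _) _.
  by rewrite lerD // distrC (le_trans Auv).
have e0 : 0 <= e by apply: le_trans (ltW d0) de.
have := iter_divn_first_order m0 t0 hF N_gt0 cvgN (hFD Dz) (hFD Dv) d0.
apply: filterS => n; rewrite -/h => step_z.
have step_U : `|U h y - (y - h *: A y)| <= 3 * (h * e).
  apply: le_trans (semigroup_first_order archK hU hy hu h0) _.
  have -> : 3 * (h * e) = 2 * h * e + h * e by ring.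
  apply: lerD; first by rewrite ler_wpM2l // mulr_ge0.
  rewrite expr2 -mulrA ler_wpM2l // (le_trans _ he) // ler_wpM2l //.
  by apply: le_trans Auw _; rewrite lerDl.
have step_F : `|iter (N n %/ m) (F n) z - (z - h *: A z)| <= 7 * (h * e) + d.
  rewrite opprB addrA addrAC; apply: le_trans step_z _; rewrite lerD2r.
  have -> : 7 * (h * e) = 2 * h * (3 * e) + h * e by ring.
  apply: lerD; first by rewrite ler_wpM2l // mulr_ge0.
  by rewrite expr2 -mulrA ler_wpM2l // (le_trans _ he) // ler_wpM2l.
have step_yz : `|(z - h *: A z) - (y - h *: A y)| <= d + h * e.
  have -> : (z - h *: A z) - (y - h *: A y) = (z - y) + h *: (A y - A z).
    rewrite scalerBr opprB; move: (h *: A z) (h *: A y) => p q.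
    by rewrite [q - y]addrC addrACA [- p + q]addrC.
  apply: le_trans (ler_normD _ _) _; rewrite distrC lerD //.
  by rewrite normrZ ger0_norm // ler_wpM2l // (le_trans Ayz).
have -> : 11 * (h * e) + 3 * d =
  d + ((7 * (h * e) + d) + ((d + h * e) + 3 * (h * e))) by ring.
apply: le_trans (ler_distD (iter (N n %/ m) (F n) z) _ _) _; apply: lerD.
  exact: le_trans (iter_nonexpB _ _ _ (hF n)) yz.
apply: le_trans (ler_distD (z - h *: A z) _ _) _; apply: lerD => //.
apply: le_trans (ler_distD (y - h *: A y) _ _) _; apply: lerD => //.
by rewrite distrC.
Qed.

Lemma cvg_iter_core x : D x -> iter (N n) (F n) x @[n --> \oo] --> U t x.
Proof.
move=> Dx; have hx := core_dom Dx.
apply/cvgrPdist_le => eps eps0.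
have c0 : 0 < 11 * t + 4 by rewrite ltr_wpDl // mulr_ge0.
(* The m local errors 11 h e + 3 d add up to 11 t e + 3 e, and the fewer than m
   steps left over by the division of N_n by m cost another e. *)
pose e := eps / (11 * t + 4).
have e0 : 0 < e by rewrite divr_gt0.
have e_ge0 := ltW e0.
have [w hw xw] := dom_generator_dense archK hU (A x) e0.
have [m hm] := archK (t * (`|A w| + e) / e).
have [m0 he] : (0 < m)%N /\ t / m%:R * (`|A w| + e) <= e.
  have q0 : 0 <= t * (`|A w| + e) / e.
    by apply: divr_ge0 => //; apply: mulr_ge0 => //; apply: addr_ge0.
  rewrite ger0_norm // in hm.
  have m0 : (0 < m)%N.
    by rewrite -(ltr_nat K); apply: le_lt_trans hm.
  split => //; rewrite mulrAC ler_pdivrMr ?ltr0n // [leRHS]mulrC -ler_pdivrMr //.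
  exact: ltW.
have mR0 : m%:R != 0 :> K by rewrite pnatr_eq0 -lt0n.
pose h := t / m%:R; pose d := e / m%:R.
have d0 : 0 < d by rewrite divr_gt0 // ltr0n.
have de : d <= e by rewrite ler_pdivrMr ?ltr0n // -[leLHS]mulr1 ler_wpM2l // ler1n.
pose y k := U (k%:R * h) x.
have hk k : 0 <= k%:R * h by rewrite mulr_ge0 // divr_ge0.
have steps : \forall n \near \oo, forall k : 'I_m,
    `|iter (N n %/ m) (F n) (y k) - y k.+1| <= 11 * (h * e) + 3 * d.
  apply: filter_forall => k.
  have := orbit_step m0 (hk k) hx hw xw d0 de he.
  apply: filterS => n; rewrite -(semigroupD hU) ?divr_ge0 //.
  have -> // : h + k%:R * h = k.+1%:R * h by rewrite [in RHS]mulrSr mulrDl mul1r addrC.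
have rest : \forall n \near \oo, m%:R * `|F n x - x| <= e.
  have cv : m%:R * ((N n)%:R^-1 * `|(N n)%:R *: (F n x - x)|) @[n --> \oo]
      --> m%:R * (0 * `|- (t *: A x)| : K).
    apply: cvgM; first exact: cvg_cst.
    by apply: cvgM => //; apply: cvg_norm; exact: hFD.
  rewrite mul0r mulr0 in cv; move/cvgrPdist_le/(_ _ e0): cv.
  apply: filterS => n.
  rewrite sub0r normrN ger0_norm; last first.
    by apply: mulr_ge0 => //; apply: mulr_ge0; rewrite ?invr_ge0.
  by rewrite [`|_ *: _|]normrZ normr_nat mulKf // pnatr_eq0 -lt0n.
near=> n.
have stepn : forall k : 'I_m,
    `|iter (N n %/ m) (F n) (y k) - y k.+1| <= 11 * (h * e) + 3 * d by near: n.
have restn : m%:R * `|F n x - x| <= e by near: n.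
rewrite distrC (divn_eq (N n) m) addnC iterD.
have -> : eps = e + m%:R * (11 * (h * e) + 3 * d).
  have -> : eps = (11 * t + 4) * e by rewrite mulrC divfK ?gt_eqF.
  by rewrite /h /d; field.
apply: le_trans (ler_distD (iter (N n %/ m * m) (F n) x) _ _) _; apply: lerD.
  set p := iter (N n %/ m * m) (F n).
  have comm k v : iter k (F n) (p v) = p (iter k (F n) v).
    by rewrite /p -!iterD addnC.
  rewrite comm; apply: le_trans (iter_nonexpB _ _ _ (hF n)) _.
  apply: le_trans (iter_displacement _ _ (hF n)) (le_trans _ restn).
  by rewrite ler_wpM2r // ler_nat ltnW // ltn_pmod.
have -> : U t x = y m by rewrite /y mulrC divfK.
have -> : x = y 0%N by rewrite /y mul0r (semigroup0 hU).
rewrite mulnC iterM; apply: iter_telescope => [u v|k km].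
  exact: iter_nonexpB.
exact: (stepn (Ordinal km)).
Unshelve. all: by end_near. Qed.

(** The number N_n of steps is kept apart from the index n so that each F_n may
    be iterated as often as its own approximation requires. *)
Theorem cvg_iter_semigroup x : iter (N n) (F n) x @[n --> \oo] --> U t x.
Proof.
apply/cvgrPdist_le => e e0; have e30 : 0 < e / 3 by rewrite divr_gt0.
have [z Dz xz] := core_dense x e30.
move/cvgrPdist_le/(_ _ e30): (cvg_iter_core Dz); apply: filterS => n hn.
have -> : e = e / 3 + (e / 3 + e / 3) by field.
apply: le_trans (ler_distD (U t z) _ _) _; apply: lerD.
  by apply: le_trans (semigroup_dist hU _ _ t0) xz.
apply: le_trans (ler_distD (iter (N n) (F n) z) _ _) _; apply: lerD => //.
by apply: le_trans (iter_nonexpB _ _ _ (hF n)) _; rewrite distrC.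
Qed.

End Chernoff.

(** * The exponential as a limit of powers *)

Lemma exp_leq_factM a k : (a ^ k <= a ^ a * k`!)%N.
Proof.
elim: k => [|k IH]; first by rewrite expn0 muln1 expn_gt0; case: a.
have [ka|ak] := ltnP k a.
  rewrite -[leqLHS]muln1; apply: leq_mul; last exact: fact_gt0.
  by rewrite leq_pexp2l // (leq_trans _ ka).
rewrite expnS factS mulnCA; apply: leq_mul IH.
exact: leqW.
Qed.

(** The factor 8 = 2 * 4 leaves room both for a geometric decay in 2^-k and for
    the polynomial factor k^2 + 1 <= 4^k: the errors of [exp_coeff_bound]
    contain k^2. *)
Lemma poly_exp_leq_fact b k :
  ((k ^ 2).+1 * b ^ k * 2 ^ k <= (8 * b) ^ (8 * b) * k`!)%N.
Proof.
apply: leq_trans (exp_leq_factM _ _).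
have k4 : ((k ^ 2).+1 <= 4 ^ k)%N.
  have -> : (4 ^ k = (2 ^ k) ^ 2)%N by rewrite -expnM mulnC expnM.
  apply: leq_trans (_ : k.+1 ^ 2 <= _)%N; last by rewrite leq_exp2r // ltn_expl.
  by rewrite ltn_exp2r.
have -> : ((8 * b) ^ k = 4 ^ k * b ^ k * 2 ^ k)%N.
  by rewrite -!expnMn; congr (_ ^ _)%N; rewrite mulnAC.
by rewrite !leq_mul.
Qed.

Lemma ffact_leq_exp N k : (N ^_ k <= N ^ k)%N.
Proof. by elim: k => // k IH; rewrite ffactnSr expnSr leq_mul // leq_subr. Qed.

(** Divided by N^(k+1), this is 1 - (1 - 1/N) ... (1 - (k-1)/N) <= k^2 / N: the
    coefficient of B^k in (1 + B/N)^N is within k^2 / (N k!) of 1/k!. *)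
Lemma ffact_ge N k : (N ^ k.+1 <= N * N ^_ k + k ^ 2 * N ^ k)%N.
Proof.
elim: k => [|k IH]; first by rewrite expn1 ffactn0 muln1 leq_addr.
rewrite expnS; apply: leq_trans (leq_mul (leqnn N) IH) _.
have split_N : (N * N ^_ k * N <= N * N ^_ k.+1 + k * N ^ k.+1)%N.
  apply: leq_trans (_ : N * N ^_ k * (N - k + k) <= _)%N.
    by rewrite leq_mul2l addnC -leq_subLR leqnn orbT.
  rewrite mulnDr ffactnSr mulnA leq_add2l mulnC leq_mul2l expnS.
  by rewrite leq_mul2l ffact_leq_exp !orbT.
rewrite mulnDr [(N * (N * _))%N]mulnC.
apply: leq_trans (leq_add split_N (leqnn _)) _.
rewrite -addnA leq_add2l mulnCA -expnS -mulnDl leq_mul2r; apply/orP; right.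
by rewrite -!mulnn; nia.
Qed.

Section ExpLimit.
Variables (K : numFieldType) (X : completeNormedModType K).
Hypothesis archK : Num.archimedean_axiom K.
Variables (B : {linear X -> X}).

Lemma iter_binomial c N x : iter N (fun y => y + c *: B y) x =
  \sum_(0 <= k < N.+1) ('C(N, k)%:R * c ^+ k) *: iter k B x.
Proof.
elim: N => [|N IH].
  by rewrite big_nat1 bin0 mul1r expr0 scale1r.
rewrite iterS IH linear_sum scaler_sumr [RHS]big_nat_recl //=.
rewrite bin0 expr0 mulr1 scale1r.
under [in RHS]eq_bigr => k _ do rewrite binS natrD mulrDl scalerDl.
rewrite big_split /= addrA; congr (_ + _).
  rewrite big_nat_recl //= bin0 expr0 mulr1 scale1r; congr (_ + _).
  by rewrite [RHS]big_nat_recr //= bin_small // mul0r scale0r addr0.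
by apply: eq_bigr => k _; rewrite linearZ scalerA mulrCA -exprS.
Qed.

Variables (b : nat) (hB : forall y, `|B y| <= b%:R * `|y|).
Let c : K := ((8 * b) ^ (8 * b))%:R.

Lemma iter_bounded k x : `|iter k B x| <= b%:R ^+ k * `|x|.
Proof.
elim: k => [|k IH]; first by rewrite mul1r.
rewrite exprS -mulrA; apply: le_trans (hB _) _.
by rewrite ler_wpM2l.
Qed.

Lemma exp_term_bound k x :
  (k ^ 2).+1%:R * `|(k`!%:R : K)^-1 *: iter k B x| <= c * `|x| * 2^-1 ^+ k.
Proof.
have f0 : 0 < k`!%:R :> K by rewrite ltr0n fact_gt0.
rewrite normrZ ger0_norm ?invr_ge0 // exprVn ler_pdivlMr ?exprn_gt0 ?ltr0Sn //.
set q := `|_|.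
have -> : (k ^ 2).+1%:R * (k`!%:R^-1 * q) * 2 ^+ k
    = k`!%:R^-1 * ((k ^ 2).+1%:R * q * 2 ^+ k) by ring.
rewrite ler_pdivrMl //.
apply: le_trans (_ : (k ^ 2).+1%:R * (b%:R ^+ k * `|x|) * 2 ^+ k <= _).
  by rewrite ler_wpM2r ?exprn_ge0 // ler_wpM2l //; exact: iter_bounded.
have -> : (k ^ 2).+1%:R * (b%:R ^+ k * `|x|) * 2 ^+ k
    = (k ^ 2).+1%:R * b%:R ^+ k * 2 ^+ k * `|x| by ring.
rewrite mulrA ler_wpM2r // -!natrX -!natrM ler_nat.
by rewrite [leqRHS]mulnC; exact: poly_exp_leq_fact.
Qed.

Lemma geometric_half m n : (m <= n)%N ->
  \sum_(m <= k < n) (2^-1 : K) ^+ k <= 2 * 2^-1 ^+ m.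
Proof.
move=> mn; suff -> : \sum_(m <= k < n) (2^-1 : K) ^+ k = 2 * 2^-1 ^+ m - 2 * 2^-1 ^+ n.
  by rewrite lerBlDr lerDl mulr_ge0 ?exprn_ge0 ?invr_ge0.
elim: n mn => [|n IH]; first by rewrite leqn0 => /eqP ->; rewrite big_geq // subrr.
rewrite leq_eqVlt => /orP[/eqP <-|]; first by rewrite big_geq // subrr.
rewrite ltnS => mn; rewrite big_nat_recr //= IH // exprS; by field.
Qed.

Lemma exp_partial_sum (a : nat -> X) (x : X) m n : (m <= n)%N ->
  (forall k, (m <= k < n)%N -> `|a k| <= c * `|x| * 2^-1 ^+ k) ->
  `|\sum_(m <= k < n) a k| <= c * `|x| * (2 * 2^-1 ^+ m).
Proof.
move=> mn ha; apply: le_trans (ler_norm_sum _ _ _) _.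
apply: le_trans (ler_sum_nat ha) _.
by rewrite -mulr_sumr ler_wpM2l ?mulr_ge0 // geometric_half.
Qed.

Lemma cvg_exp_series x :
  series (fun k => (k`!%:R : K)^-1 *: iter k B x) @ \oo --> exp_op B x.
Proof.
apply: cauchy_seq_cvg => e e0.
set u := fun k : nat => (k`!%:R)^-1 *: _; set M := c * `|x| * 2.
have M0 : 0 <= M by rewrite /M mulr_ge0 // mulr_ge0.
have [n0 hn0] := invSn_lt archK (divr_gt0 e0 (ltr_wpDl M0 ltr01)).
have tail m n : (n0 <= m)%N -> (m <= n)%N -> `|series u n - series u m| <= e.
  move=> m0 mn; rewrite sub_series_geq //.
  apply: le_trans (exp_partial_sum (x := x) mn _) _.
    move=> k _; apply: le_trans (exp_term_bound k x).
    by rewrite -{1}[`|u k|]mul1r ler_wpM2r // ler1n.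
  rewrite mulrA -/M; apply: le_trans (_ : M * (e / (M + 1)) <= _).
    rewrite ler_wpM2l // exprVn; apply: le_trans (ltW hn0).
    rewrite -natrX lef_pV2 ?posrE ?ltr0n ?expn_gt0 // ler_nat.
    exact: leq_ltn_trans m0 (ltn_expl _ _).
  rewrite mulrCA ler_piMr ?ltW // ltr_pdivrMr ?mul1r ?ltrDl //.
  by rewrite ltr_wpDl.
exists n0 => n m hn hm; have [nm|/ltnW mn] := leqP n m; last exact: tail.
by rewrite distrC tail.
Qed.

Lemma exp_coeff_bound N k : (0 < N)%N ->
  `|k`!%:R^-1 - 'C(N, k)%:R * N%:R^-1 ^+ k| <= N%:R^-1 * ((k ^ 2)%:R * k`!%:R^-1) :> K.
Proof.
move=> N0; have N0' : N%:R != 0 :> K by rewrite pnatr_eq0 -lt0n.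
have f0 : k`!%:R != 0 :> K by rewrite pnatr_eq0 -lt0n fact_gt0.
have NR0 : 0 < N%:R :> K by rewrite ltr0n.
have fR0 : 0 < k`!%:R :> K by rewrite ltr0n fact_gt0.
have -> : k`!%:R^-1 - 'C(N, k)%:R * N%:R^-1 ^+ k =
    ((N ^ k)%:R - (N ^_ k)%:R) / (k`!%:R * (N ^ k)%:R) :> K.
  rewrite -bin_ffact natrM natrX exprVn; field.
  by rewrite f0 expf_neq0.
rewrite -natrB ?ffact_leq_exp // ger0_norm ?divr_ge0 ?mulr_ge0 //.
rewrite ler_pdivrMr; last by rewrite mulr_gt0 // ltr0n expn_gt0 N0.
have -> : N%:R^-1 * ((k ^ 2)%:R / k`!%:R) * (k`!%:R * (N ^ k)%:R)
    = N%:R^-1 * ((k ^ 2)%:R * (N ^ k)%:R) :> K by field; rewrite N0' f0.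
rewrite ler_pdivlMl // -!natrM ler_nat.
by rewrite mulnBr leq_subLR -expnS ffact_ge.
Qed.

(** The N-th power and the partial sum of degree N of the series differ by
    O(1/N), coefficient by coefficient. *)
Lemma cvg_iter_exp_op x :
  iter n.+1 (fun y => y + n.+1%:R^-1 *: B y) x @[n --> \oo] --> exp_op B x.
Proof.
pose u k := (k`!%:R : K)^-1 *: iter k B x.
have diff n : `|series u n.+2 - iter n.+1 (fun y => y + n.+1%:R^-1 *: B y) x|
    <= n.+1%:R^-1 * (c * `|x| * 2).
  rewrite iter_binomial /series /= -sumrB.
  rewrite ler_pdivlMl ?ltr0Sn //.
  rewrite -[X in X * `|_|]normr_nat -normrZ scaler_sumr.
  rewrite -[2 in leRHS]mulr1 -(expr0 2^-1).
  apply: exp_partial_sum => // k _.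
  apply: le_trans (exp_term_bound k x).
  rewrite -scalerBl normrZ normr_nat normrZ.
  apply: le_trans (_ : n.+1%:R * (n.+1%:R^-1 * ((k ^ 2)%:R * k`!%:R^-1)
     * `|iter k B x|) <= _).
    by rewrite ler_wpM2l // ler_wpM2r // exp_coeff_bound.
  rewrite mulrA mulVKf ?pnatr_eq0 // -mulrA normrZ ger0_norm ?invr_ge0 //.
  by rewrite ler_wpM2r ?mulr_ge0 ?invr_ge0 // ler_nat.
have c1 : series u n.+2 @[n --> \oo] --> exp_op B x.
  have := @cvg_exp_series x; rewrite -cvg_shiftS -cvg_shiftS; exact.
have c2 : n.+1%:R^-1 * (c * `|x| * 2) @[n --> \oo] --> (0 * (c * `|x| * 2) : K).
  by apply: cvgM; [exact: cvg_invSn|exact: cvg_cst].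
rewrite mul0r in c2.
apply/cvgrPdist_le => e e0; have e20 : 0 < e / 2 by rewrite divr_gt0.
near=> n; apply: le_trans (ler_distD (series u n.+2) _ _) _.
rewrite [leRHS]splitr; apply: lerD.
  by near: n; move/cvgrPdist_le: c1; apply.
apply: le_trans (diff n) _; near: n.
move/cvgrPdist_le/(_ _ e20): c2; apply: filterS => n.
by rewrite sub0r normrN ger0_norm // ?mulr_ge0 ?invr_ge0.
Unshelve. all: by end_near. Qed.

End ExpLimit.

(** * Convergence of the powers and of the exponentials *)

Lemma archimedean_real_or_complex (R : realType) (K : numFieldType) :
  K = R :> numFieldType \/ K = R[i] :> numFieldType -> Num.archimedean_axiom K.
Proof.
have archR (r : R) : 0 <= r -> exists n : nat, r < n%:R.
  by move=> r0; exists (Num.bound r); exact: archi_boundP.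
case=> -> z; first exact: archR.
move: `|z| (normr_ge0 z) => w w0; have wIm := ger0_Im w0.
have [|n hn] := archR (complex.Re w); first by move: w0; rewrite lecE => /andP[].
exists n; rewrite (_ : n%:R = (n%:R)%:C%C); last by rewrite rmorph_nat.
by rewrite ltcE /= wIm eqxx.
Qed.

Section Exponential.
Variables (K : numFieldType) (X : completeNormedModType K).
Hypothesis archK : Num.archimedean_axiom K.
Variables (U : K -> {linear X -> X}) (hU : contraction_C0_semigroup U).
Variables (D : set X) (hD : is_core (dom_generator U) (generator U) D).
Variables (C : nat -> {linear X -> X}) (t : K).
Hypotheses (hC : forall n, contractive (C n)) (t0 : 0 <= t).
Hypothesis hCD : forall z, D z ->
  n.+1%:R *: (C n z - z) @[n --> \oo] --> - (t *: generator U z).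

Let B n : {linear X -> X} := n.+1%:R \*: (C n \- idfun).

Lemma convex_contractive (p : K) n : 0 <= p -> p <= 1 ->
  contractive (idfun \+ p \*: (C n \- idfun) : {linear X -> X}).
Proof.
move=> p0 p1 y /=.
have -> : y + p *: (C n y - y) = (1 - p) *: y + p *: C n y.
  by rewrite scalerBr scalerBl scale1r addrCA addrC.
apply: le_trans (ler_normD _ _) _; rewrite !normrZ !ger0_norm ?subr_ge0 //.
apply: le_trans (_ : (1 - p) * `|y| + p * `|y| <= _).
  by rewrite lerD2l ler_wpM2l //; exact: hC.
by rewrite -mulrDl subrK mul1r.
Qed.

Lemma exp_op_approx n x : exists M, (n <= M)%N /\
  `|exp_op (B n) x - iter M.+1 (fun y => y + M.+1%:R^-1 *: B n y) x| <= n.+1%:R^-1.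
Proof.
have hB y : `|B n y| <= (n.+1 * 2)%:R * `|y|.
  rewrite /B /= normrZ normr_nat natrM -mulrA ler_wpM2l //.
  apply: le_trans (ler_normB _ _) _.
  by rewrite mulr_natl mulr2n lerD2r; exact: hC.
have e0 : 0 < n.+1%:R^-1 :> K by rewrite invr_gt0 ltr0Sn.
have /cvgrPdist_le/(_ _ e0) [M _ hM] := @cvg_iter_exp_op K X archK (B n) _ hB x.
by exists (maxn M n); split; [exact: leq_maxr | exact: (hM _ (leq_maxl _ _))].
Qed.

(** A diagonal argument: M_n is chosen along the limit (1 + B_n/M)^M -> exp B_n
    at the vector x, and M_n >= n makes 1 + B_n/M_n a contraction. *)
Lemma cvg_exp_op_semigroup x : exp_op (B n) x @[n --> \oo] --> U t x.
Proof.
have [M hM] := choice (fun n => exp_op_approx n x).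
pose F n : {linear X -> X} := idfun \+ (M n).+1%:R^-1 \*: B n.
have hF n : contractive (F n).
  move=> y; set p : K := n.+1%:R / (M n).+1%:R.
  have -> : F n y = (idfun \+ p \*: (C n \- idfun)) y.
    by rewrite /F /B /= scalerA mulrC.
  apply: convex_contractive; first by rewrite divr_ge0.
  by rewrite ler_pdivrMr ?ltr0Sn // mul1r ler_nat ltnS; case: (hM n).
have c1 : iter (M n).+1 (F n) x @[n --> \oo] --> U t x.
  apply: (@cvg_iter_semigroup _ _ archK _ hU _ hD F (fun n => (M n).+1)) => //.
    by move=> n; rewrite ltnS; case: (hM n).
  move=> z Dz; apply: cvg_trans (hCD Dz).
  by under eq_fun do
    rewrite /F /= [_ + _ *: _]addrC addrK scalerA divff ?pnatr_eq0 // scale1r.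
apply/cvgrPdist_le => e e0; have e20 : 0 < e / 2 by rewrite divr_gt0.
near=> n; apply: le_trans (ler_distD (iter (M n).+1 (F n) x) _ _) _.
rewrite [leRHS]splitr; apply: lerD.
  by near: n; move/cvgrPdist_le: c1; apply.
have [_ hn] := hM n; rewrite distrC; apply: le_trans hn _; near: n.
move/cvgrPdist_le/(_ _ e20): (cvg_invSn archK); apply: filterS => n.
by rewrite sub0r normrN ger0_norm ?invr_ge0.
Unshelve. all: by end_near. Qed.

End Exponential.

Theorem corollary3p1 (R : realType) (K : numFieldType)
    (hK : K = R :> numFieldType \/ K = R[i] :> numFieldType)
    (X : completeNormedModType K)
    (Phi : K -> {linear X -> X})
    (hPhi : forall t : K, 0 <= t -> contractive (Phi t))
    (hPhi0 : forall x : X, Phi 0 x = x)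
    (U : K -> {linear X -> X})
    (hU : contraction_C0_semigroup U)
    (D : set X)
    (hD : is_core (dom_generator U) (generator U) D)
    (hderiv : forall x : X, D x ->
       dom_rderiv0 Phi x /\ rderiv0 Phi x = - generator U x) :
  forall (t : K) (x : X), 0 <= t ->
    `| iter n (Phi (t / n%:R)) x
       - exp_op (fun y => n%:R *: (Phi (t / n%:R) y - y)) x |
      @[n --> \oo] --> (0 : K)
    /\ iter n (Phi (t / n%:R)) x @[n --> \oo] --> U t x.
Proof.
move=> t x t0; have archK := archimedean_real_or_complex hK.
pose C n := Phi (t / n.+1%:R).
have hC n : contractive (C n) by apply: hPhi; rewrite divr_ge0.
have hCD z : D z -> n.+1%:R *: (C n z - z) @[n --> \oo] --> - (t *: generator U z).
  move=> /hderiv [dz Ez]; rewrite -scalerN -Ez.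
  exact (cvg_scaled_displacement archK hPhi0 dz t0).
(* The index is shifted by one so that the number of steps is positive. *)
have powers : iter n (Phi (t / n%:R)) x @[n --> \oo] --> U t x.
  rewrite -cvg_shiftS.
  exact: (@cvg_iter_semigroup _ _ archK _ hU _ hD C succn).
have exps : exp_op (fun y => n%:R *: (Phi (t / n%:R) y - y)) x @[n --> \oo] --> U t x.
  rewrite -cvg_shiftS.
  exact: (@cvg_exp_op_semigroup _ _ archK _ hU _ hD C t hC t0 hCD x).
split=> //.
have := cvg_norm (cvgB powers exps); rewrite subrr normr0; exact.
Qed.
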